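(* Let $f_1,\dots,f_N:\mathbb{R}^n\to\mathbb{R}^n$ be contracting similarities with ratios $\rho_1,\dots,\rho_N\in(0,1)$, let $C\subset\mathbb{R}^n$ be a non-empty compact set, let $E$ be a sub-self-similar set for $\{f_i\}_{i=1}^N$ with $E=\Theta(S)$, where $S\subseteq I^\infty$ is compact and closed under left shift, let $O_S=C\cup\bigcup_{\omega\in S^*}f_\omega(C)$, and let $F=E\cup O_S$. Then there exists a sequence of IFSs $\{I_k\}_{k=1}^\infty$ of contracting similarities, with inhomogeneous sub-self-similar sets $F_k=E_k\cup O_S$ corresponding to $I_k$ with condensation set $C$ (where $E_k$ is a sub-self-similar set for $I_k$), such that, if $\{f_1,\dots,f_N,C\}$ satisfies the inhomogeneous open set condition, then $$\dim_H E=\lim_{k\to\infty}\dim_H E_k=\lim_{k\to\infty}s_k,$$ where $s_k=\dim_H E_k$ is the number uniquely determined by $\sum_{\omega\in S^k}\rho_\omega^{s_k}=1$.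
   Context: $\dim_H$ denotes Hausdorff dimension. An IFS is a finite family of contracting similarities. A non-empty compact set $E$ is a sub-self-similar (SSS) set for an IFS $\{g_j\}_j$ if $E\subseteq\bigcup_j g_j(E)$. A non-empty compact set $F$ is an inhomogeneous sub-self-similar (ISSS) set for $\{g_j\}_j$ with condensation set $C$ if $F\subseteq\bigcup_j g_j(F)\cup C$. Inhomogeneous open set condition (IOSC) for $\{f_1,\dots,f_N,C\}$: there is a non-empty bounded open $U$ with $\bigcup_i f_i(U)\subseteq U$, $f_i(U)\cap f_j(U)=\emptyset$ for $i\neq j$, and $C\subset U$. Code space: $I=\{1,\dots,N\}$, $I^\infty$ is the set of infinite sequences in $I$ with the product topology. For a finite word $\omega=\omega_1\cdots\omega_m$ put $f_\omega=f_{\omega_1}\circ\cdots\circ f_{\omega_m}$ and $\rho_\omega=\rho_{\omega_1}\cdots\rho_{\omega_m}$. The coding map is $\Theta(\omega)=\lim_{m\to\infty}f_{\omega_1}\circ\cdots\circ f_{\omega_m}(x)$ (independent of $x$). $S$ is closed under left shift if $\omega_1\omega_2\omega_3\cdots\in S$ implies $\omega_2\omega_3\cdots\in S$. For $m\ge1$, $S^m=\{\omega_1\cdots\omega_m:\omega\in S\}$ and $S^*=\bigcup_{m\ge1}S^m$. *)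

(* Defs.v *)
From mathcomp Require Import all_boot all_order all_algebra.
From mathcomp Require Import all_classical all_reals all_analysis.

Set Implicit Arguments.
Unset Strict Implicit.
Unset Printing Implicit Defensive.

Import Order.TTheory GRing.Theory Num.Theory.
Import numFieldNormedType.Exports.

Local Open Scope classical_set_scope.
Local Open Scope ring_scope.

Section HausdorffDimension.
Context {R : realType} {n : nat}.
Implicit Types (x y : 'rV[R]_n) (A : set 'rV[R]_n) (s delta : R).

(* The norm `|x| of the library on 'rV[R]_n is the sup norm: it induces the
   usual topology and bounded sets, but similarities and diameters below are
   taken with respect to the Euclidean distance. *)
Definition eucl_dist x y : R :=
  Num.sqrt (\sum_(i < n) (x ord0 i - y ord0 i) ^+ 2).

(* equal to -oo on the empty set *)
Definition diam A : \bar R :=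
  ereal_sup [set d | exists x y, [/\ A x, A y & d = (eucl_dist x y)%:E]].

(* diam(A)^s, where the empty set contributes 0 even when s = 0, whereas
   diam(A)^0 = 1 for every non-empty A *)
Definition diam_pow s A : \bar R :=
  if A == set0 then 0%E else poweR (diam A) s.

Definition hausdorff_pre s delta A : \bar R :=
  ereal_inf [set (\sum_(0 <= i <oo) diam_pow s (U i))%E |
    U in [set U : nat -> set 'rV[R]_n |
            A `<=` \bigcup_i U i /\ forall i, (diam (U i) <= delta%:E)%E]].

Definition hausdorff_measure s A : \bar R :=
  ereal_sup [set hausdorff_pre s delta A | delta in [set delta | 0 < delta]].

Definition hausdorff_dim A : \bar R :=
  ereal_inf [set s%:E | s in [set s | 0 <= s /\ hausdorff_measure s A = 0%E]].

End HausdorffDimension.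

Section IteratedFunctionSystems.
Context {R : realType} {n : nat}.
Local Notation V := 'rV[R]_n.

Definition contracting_similarity (g : V -> V) (r : R) : Prop :=
  0 < r < 1 /\ forall x y, eucl_dist (g x) (g y) = r * eucl_dist x y.

Definition is_IFS (M : nat) (g : 'I_M -> V -> V) : Prop :=
  forall j, exists r, contracting_similarity (g j) r.

Definition sub_self_similar (M : nat) (g : 'I_M -> V -> V) (E : set V) : Prop :=
  [/\ E !=set0, compact E & E `<=` \bigcup_j (g j @` E)].

Definition inhom_sub_self_similar (M : nat) (g : 'I_M -> V -> V)
    (C F : set V) : Prop :=
  [/\ F !=set0, compact F & F `<=` (\bigcup_j (g j @` F)) `|` C].

Definition inhom_open_set_condition (M : nat) (g : 'I_M -> V -> V)
    (C : set V) : Prop :=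
  exists U : set V,
    [/\ [/\ U !=set0, bounded_set U & open U],
        \bigcup_i (g i @` U) `<=` U,
        (forall i j, i != j -> (g i @` U) `&` (g j @` U) = set0)
      & C `<=` U].

End IteratedFunctionSystems.

(* sequences of symbols, indexed from 0, with the product of the discrete
   topologies *)
Notation code_space N :=
  (prod_topology (fun _ : nat => discrete_topology 'I_N)).

Section CodeSpace.
Context {N : nat}.
Implicit Types (S : set (code_space N)) (w : code_space N).

Definition shift_code w : code_space N := fun i => w i.+1.

Definition shift_closed S : Prop := forall w, S w -> S (shift_code w).

Definition prefix_word w (m : nat) : seq 'I_N := mkseq w m.

(* S^m and S^* *)
Definition words S (m : nat) : set (seq 'I_N) :=
  [set prefix_word w m | w in S].

Definition all_words S : set (seq 'I_N) :=
  \bigcup_(m in [set m | (0 < m)%N]) words S m.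

Context {R : realType} {n : nat}.
Variables (f : 'I_N -> 'rV[R]_n -> 'rV[R]_n) (rho : 'I_N -> R).

Definition word_map (u : seq 'I_N) : 'rV[R]_n -> 'rV[R]_n :=
  foldr (fun i g => f i \o g) id u.

Definition word_ratio (u : seq 'I_N) : R := \prod_(i <- u) rho i.

(* For contractions the limit exists and does not depend on the base point,
   here taken to be 0. *)
Definition coding (w : code_space N) : 'rV[R]_n :=
  lim ((fun m : nat => word_map (prefix_word w m) 0) @ \oo).

Definition orbital_set (S : set (code_space N)) (C : set 'rV[R]_n) : set 'rV[R]_n :=
  C `|` \bigcup_(u in all_words S) (word_map u @` C).

End CodeSpace.

(* Main.v *)
Require Import Defs.
From mathcomp Require Import all_boot all_order all_algebra.
From mathcomp Require Import all_classical all_reals all_analysis.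
From mathcomp Require Import ring lra zify.
Import Order.TTheory GRing.Theory Num.Theory.
Import numFieldNormedType.Exports.
Local Open Scope classical_set_scope.
Local Open Scope ring_scope.

(** [E_k] is the self-similar set coded by the sequences all of whose
   consecutive blocks of length [k] lie in [S^k]; as [S] is shift closed,
   [E] is contained in [E_k].  The maps of [I_k] are the [f_u] for words [u] of
   [S^1], ..., [S^k]: the words shorter than [k] are needed for the orbital set
   to be inhomogeneous sub-self-similar, and do no harm to [E_k].

   Both lower bounds on dimensions come from one argument.  Let [A] be a set of
   codes closed under the shift by [p] with [H^t(coding A) = 0].  Under the open
   set condition a ball of radius [d] meets boundedly many cylinders of ratio
   comparable to [d], so an efficient finite cover of [coding A] by balls gives
   a finite set [Q] of words, of lengths divisible by [p], such that every code in
   [A] starts with a word of [Q] and [\sum_(u in Q) rho_u^t <= 1].  Splitting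
   off prefixes in [Q] shows by induction that [\sum_(u in A^(mp)) rho_u^t] is
   bounded in [m].  For the block codes and [p = k] this sum is the [m]-th power
   of the sum over [S^k], whence [s_k <= t]; for [A = S] and [p = 1] it forces
   the sum over [S^k] to fall below 1 at any larger exponent, whence
   [limsup s_k <= dim E]. *)

(** * Euclidean distance, and surjectivity of similarities *)

Section EuclideanDistance.
Context {R : realType} {n : nat}.
Implicit Types (x y z : 'rV[R]_n).

Lemma eucl_dist_ge0 x y : 0 <= eucl_dist x y.
Proof. exact: sqrtr_ge0. Qed.

Lemma sqr_eucl_dist x y :
  eucl_dist x y ^+ 2 = \sum_(i < n) (x ord0 i - y ord0 i) ^+ 2.
Proof. by rewrite sqr_sqrtr// sumr_ge0// => i _; exact: sqr_ge0. Qed.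

Lemma eucl_distxx x : eucl_dist x x = 0.
Proof. by rewrite /eucl_dist big1 ?sqrtr0// => i _; rewrite subrr expr0n. Qed.

Lemma eucl_dist_eq0 x y : eucl_dist x y = 0 -> x = y.
Proof.
move=> xy0; have := sqr_eucl_dist x y; rewrite xy0 expr0n/= => /esym/eqP.
rewrite psumr_eq0 => [/allP sum0|i _]; last exact: sqr_ge0.
apply/rowP => i; apply/eqP; rewrite -subr_eq0 -sqrf_eq0.
by apply: sum0; rewrite mem_index_enum.
Qed.

Lemma coord_le_norm x i : `|x ord0 i| <= `|x|.
Proof.
rewrite [leRHS]/Num.norm /= mx_normrE; apply/bigmax_geP; right => /=.
by exists (ord0, i).
Qed.

Lemma norm_le_coord x (M : R) :
  0 <= M -> (forall i, `|x ord0 i| <= M) -> `|x| <= M.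
Proof.
move=> M0 xM; rewrite [leLHS]/Num.norm /= mx_normrE; apply/bigmax_leP; split=> //.
by move=> -[i j] _ /=; rewrite ord1.
Qed.

Lemma norm_le_eucl x y : `|x - y| <= eucl_dist x y.
Proof.
apply: norm_le_coord => [|i]; first exact: eucl_dist_ge0.
rewrite -(@ler_pXn2r _ 2)// ?nnegrE ?eucl_dist_ge0// sqr_eucl_dist.
rewrite (bigD1 i)//= !mxE real_normK ?num_real// lerDl.
by rewrite sumr_ge0// => j _; exact: sqr_ge0.
Qed.

(** The factor [n] comes from [n <= n ^ 2]; it is cruder than the square root of [n], but depends on
    the dimension alone. *)
Lemma eucl_le_coord x y (M : R) : 0 <= M ->
  (forall i, `|x ord0 i - y ord0 i| <= M) -> eucl_dist x y <= n%:R * M.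
Proof.
move=> M0 xyM.
rewrite -(@ler_pXn2r _ 2)// ?nnegrE ?eucl_dist_ge0 ?mulr_ge0// sqr_eucl_dist.
rewrite (@le_trans _ _ (\sum_(i < n) M ^+ 2))//.
  by apply: ler_sum => i _; rewrite -real_normK ?num_real// lerXn2r ?nnegrE.
rewrite sumr_const card_ord -[leLHS]mulr_natl exprMn ler_wpM2r ?sqr_ge0//.
by rewrite -natrX ler_nat; case: (n) => // m; rewrite -mulnn leq_pmulr.
Qed.

Lemma eucl_le_norm x y : eucl_dist x y <= n%:R * `|x - y|.
Proof.
by apply: eucl_le_coord => // i; have := coord_le_norm (x - y) i; rewrite !mxE.
Qed.

(** Inner products of vectors based at [z] are expressed through distances alone, so a map that
    scales distances scales them too. *)
Lemma eucl_polarization x y z :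
  (x - z) *m (y - z)^T =
  ((eucl_dist x z ^+ 2 + eucl_dist y z ^+ 2 - eucl_dist x y ^+ 2) / 2)%:M.
Proof.
apply/matrixP => i j; rewrite !ord1 !mxE eqxx mulr1n !sqr_eucl_dist.
rewrite -big_split/= -sumrB mulr_suml; apply: eq_bigr => k _.
by rewrite !mxE; field.
Qed.

(* A similarity multiplies inner products by r^2, so up to scaling it is
   given by an orthogonal matrix. *)
Lemma similarity_surj (g : 'rV[R]_n -> 'rV[R]_n) (r : R) : 0 < r ->
  (forall x y, eucl_dist (g x) (g y) = r * eucl_dist x y) ->
  forall y, exists x, g x = y.
Proof.
move=> r0 gE.
have gdot x y : (g x - g 0) *m (g y - g 0)^T = r ^+ 2 *: (x *m y^T).
  rewrite -[in RHS](subr0 x) -[in RHS](subr0 y) !eucl_polarization !gE.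
  by rewrite scale_scalar_mx; congr (_%:M); field.
pose A : 'M[R]_n := \matrix_(i, j) (r^-1 *: (g (delta_mx ord0 i) - g 0)) ord0 j.
have rowA i : row i A = r^-1 *: (g (delta_mx ord0 i) - g 0).
  by apply/rowP => j; rewrite !mxE.
have r_neq0 : r != 0 by rewrite gt_eqF.
(* Pairing [g x - g 0] with row [i] of [A], the rescaled image of the [i]-th basis vector, gives [r]
   times the [i]-th coordinate of [x]. *)
have gA x : (g x - g 0) *m A^T = r *: x.
  apply/rowP => i; have -> : ((g x - g 0) *m A^T) ord0 i =
      ((g x - g 0) *m (row i A)^T) ord0 ord0.
    by rewrite !mxE; apply: eq_bigr => j _; rewrite !mxE.
  by rewrite rowA linearZ/= -scalemxAr gdot scalerA trmx_delta -colE !mxE; field.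
have AA : A *m A^T = 1%:M.
  apply/row_matrixP => i; rewrite row_mul rowA -scalemxAl gA scalerA mulVf//.
  by rewrite scale1r row1.
have A_A := mulmx1C AA.
move=> y; exists (r^-1 *: (y - g 0) *m A^T).
apply: (@addIr _ (- g 0)).
set x := _ *m _.
have : (g x - g 0) *m A^T *m A = r *: x *m A by rewrite gA.
rewrite -mulmxA A_A mulmx1 => ->.
by rewrite /x -scalemxAl -mulmxA A_A mulmx1 scalerA mulfV// scale1r.
Qed.

End EuclideanDistance.

(** * Prefixes, shifts and concatenation of codes *)

Section Words.
Context {N : nat}.
Implicit Types (w : code_space N) (u v : seq 'I_N).

Definition shift_by (m : nat) w : code_space N := fun i => w (m + i)%N.

(** The default value of [nth] does the work: it is what is read past the end of [u]. *)
Definition cat_code u w : code_space N :=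
  fun i => nth (w (i - size u)%N) u i.

Lemma size_prefix_word w m : size (prefix_word w m) = m.
Proof. exact: size_mkseq. Qed.

Lemma prefix_wordD w m l :
  prefix_word w (m + l) = prefix_word w m ++ prefix_word (shift_by m w) l.
Proof.
rewrite /prefix_word /mkseq iotaD map_cat; congr (_ ++ _).
by rewrite add0n -{1}[m]addn0 iotaDl -map_comp.
Qed.

Lemma prefix_wordS w m :
  prefix_word w m.+1 = prefix_word w m ++ [:: w m].
Proof. by rewrite -addn1 prefix_wordD /prefix_word /mkseq/= /shift_by addn0. Qed.

Lemma take_prefix_word w m l : (m <= l)%N ->
  take m (prefix_word w l) = prefix_word w m.
Proof.
by move=> ml; rewrite -(subnKC ml) prefix_wordD take_size_cat ?size_prefix_word.
Qed.

Lemma eq_prefix_word w w' m :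
  (prefix_word w m = prefix_word w' m) <-> (forall i, (i < m)%N -> w i = w' i).
Proof.
split=> [e i im|e]; last first.
  by apply/eq_in_map => i; rewrite mem_iota => /andP[_]; exact: e.
have := congr1 (fun s => nth (w 0) s i) e.
by rewrite !nth_mkseq.
Qed.

Lemma shift_byD w m l : shift_by m (shift_by l w) = shift_by (l + m) w.
Proof. by apply: functional_extensionality_dep => i; rewrite /shift_by addnA. Qed.

Lemma shift_by0 w : shift_by 0 w = w.
Proof. by apply: functional_extensionality_dep => i. Qed.

Lemma shift_closed_by (S : set (code_space N)) m w :
  shift_closed S -> S w -> S (shift_by m w).
Proof.
move=> Sshift; elim: m w => [|m IHm] w Sw; first by rewrite shift_by0.
by rewrite -add1n -shift_byD; apply: IHm; exact: Sshift.
Qed.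

Lemma prefix_cat_code u w m :
  prefix_word (cat_code u w) (size u + m) = u ++ prefix_word w m.
Proof.
rewrite prefix_wordD; congr (_ ++ _).
  apply: (@eq_from_nth _ (w 0)); rewrite size_prefix_word// => i iu.
  by rewrite nth_mkseq// /cat_code (set_nth_default (w 0)).
apply/eq_prefix_word => i _; rewrite /shift_by /cat_code.
by rewrite nth_default ?leq_addr// addKn.
Qed.

Lemma prefix_cat_code_size u w : prefix_word (cat_code u w) (size u) = u.
Proof. by rewrite -[size u]addn0 prefix_cat_code cats0. Qed.

Lemma shift_cat_code u w : shift_by (size u) (cat_code u w) = w.
Proof.
apply: functional_extensionality_dep => i; rewrite /shift_by /cat_code.
by rewrite nth_default ?leq_addr// addKn.
Qed.

(** Each coordinate is continuous into a discrete space, hence locally constant; so cylinders are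
    open. *)
Lemma near_prefix w m : \forall w' \near w, prefix_word w' m = prefix_word w m.
Proof.
elim: m => [|m IHm]; first by apply: (@nearW _ (nbhs w)) => w'.
have : \forall w' \near w, w' m = w m.
  have := @proj_continuous _ (fun=> discrete_topology 'I_N) m w.
  move=> /(_ [set w m]); apply.
  exact: (@discrete_set1 (discrete_topology 'I_N)).
by move: IHm; apply: filterS2 => w' e1 e2; rewrite !prefix_wordS e1 e2.
Qed.

End Words.

(** * Compositions along words and the coding map *)

Section Coding.
Context {R : realType} {n N : nat}.
Variables (f : 'I_N -> 'rV[R]_n -> 'rV[R]_n) (rho : 'I_N -> R).
Hypothesis hf : forall i, contracting_similarity (f i) (rho i).
Implicit Types (w : code_space N) (u v : seq 'I_N) (x y : 'rV[R]_n).

Lemma word_map_cat u v x : word_map f (u ++ v) x = word_map f u (word_map f v x).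
Proof. by elim: u => //= i u ->. Qed.

Lemma word_ratio_cat u v :
  word_ratio rho (u ++ v) = word_ratio rho u * word_ratio rho v.
Proof. exact: big_cat. Qed.

Lemma word_ratio_gt0 u : 0 < word_ratio rho u.
Proof. by apply: prodr_gt0 => i _; have [/andP[]] := hf i. Qed.

Lemma word_mapE u x y : eucl_dist (word_map f u x) (word_map f u y) =
  word_ratio rho u * eucl_dist x y.
Proof.
elim: u => [|i u IHu]/=; first by rewrite /word_ratio big_nil mul1r.
have [_ fE] := hf i.
by rewrite fE IHu /word_ratio big_cons mulrA.
Qed.

Lemma ratio_bounds : exists c q : R, [/\ 0 < c, q < 1, 0 < q &
  forall u, c ^+ size u <= word_ratio rho u <= q ^+ size u].
Proof.
(* The smallest and largest ratios; the default [2^-1] keeps both in the open unit interval, even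
   for [N = 0]. *)
exists (\big[Num.min/2^-1]_i rho i), (\big[Num.max/2^-1]_i rho i).
have c0 : 0 < \big[Num.min/2^-1]_i rho i.
  by apply/bigmin_gtP; split=> [|i _]; [rewrite invr_gt0|have [/andP[]] := hf i].
split=> //.
- by apply/bigmax_ltP; split=> [|i _]; [rewrite invf_lt1 ?ltr1n|have [/andP[]] := hf i].
- by apply/bigmax_gtP; left; rewrite invr_gt0.
elim=> [|i u /andP[cu uq]]/=; first by rewrite /word_ratio big_nil !expr0 lexx.
rewrite /word_ratio big_cons !exprS; have [/andP[r0 _] _] := hf i.
apply/andP; split; apply: ler_pM => //.
- exact: ltW.
- exact/exprn_ge0/ltW.
- exact: bigmin_le.
- exact: ltW.
- exact/ltW/word_ratio_gt0.
- exact: le_bigmax.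
Qed.

Lemma word_ratio_lt1 u : (0 < size u)%N -> word_ratio rho u < 1.
Proof.
move=> u0; have [c [q [c0 q1 q0 /(_ u) /andP[_ uq]]]] := ratio_bounds.
by rewrite (le_lt_trans uq)// exprn_ilt1 ?ltW// -lt0n.
Qed.

Lemma word_similarity u : (0 < size u)%N ->
  contracting_similarity (word_map f u) (word_ratio rho u).
Proof.
by move=> u0; split; [rewrite word_ratio_gt0 word_ratio_lt1|exact: word_mapE].
Qed.

Lemma word_map_surj u y : exists x, word_map f u x = y.
Proof. exact: similarity_surj (word_ratio_gt0 u) (word_mapE u) y. Qed.

Lemma word_map_inj u : injective (word_map f u).
Proof.
move=> x y /(congr1 (eucl_dist (word_map f u x))).
rewrite eucl_distxx word_mapE => /esym/eqP.
by rewrite mulf_eq0 gt_eqF ?word_ratio_gt0//= => /eqP; exact: eucl_dist_eq0.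
Qed.

Lemma word_map_lip u x y :
  `|word_map f u x - word_map f u y| <= word_ratio rho u * (n%:R * `|x - y|).
Proof.
apply: le_trans (norm_le_eucl _ _) _; rewrite word_mapE.
by rewrite ler_wpM2l ?eucl_le_norm// ltW// word_ratio_gt0.
Qed.

Lemma word_map_continuous u : continuous (word_map f u).
Proof.
move=> x; apply/(cvgrPdist_le (FF := nbhs_filter x)) => e e0.
have r0 := word_ratio_gt0 u.
have K0 : 0 < word_ratio rho u * (n%:R + 1) by rewrite mulr_gt0// ltr_wpDl.
near=> y; apply: le_trans (word_map_lip _ _ _) _.
apply: (@le_trans _ _ ((word_ratio rho u * (n%:R + 1)) * `|x - y|)).
  by rewrite mulrA ler_wpM2r// ler_wpM2l ?lerDl ?(ltW r0).
rewrite mulrC -ler_pdivlMr//; near: y.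
exact: (cvgrPdist_le (FF := nbhs_filter x) id x).1 (@cvg_id _ (nbhs x)) _ (divr_gt0 e0 K0).
Unshelve. all: by end_near. Qed.

Lemma word_map_cauchy : exists D q : R, [/\ 0 <= D, 0 < q, q < 1 &
  forall w m l, `|word_map f (prefix_word w m) 0 -
                  word_map f (prefix_word w (m + l)) 0| <= D * q ^+ m].
Proof.
have [c [q [c0 q1 q0 cq]]] := ratio_bounds.
(* One more letter after a word of length [j] moves the image of 0 by at most [b * q ^+ j];
   [b / (1 - q)] sums the geometric series. *)
pose b := \big[Num.max/0]_i eucl_dist 0 (f i 0).
have b0 : 0 <= b by apply/bigmax_geP; left.
exists (b / (1 - q)), q; split=> //; first by rewrite divr_ge0// subr_ge0 ltW.
move=> w m l.
(* The exact partial sum of the series is what the induction on [l] can carry. *)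
apply: (@le_trans _ _ (b / (1 - q) * (q ^+ m - q ^+ (m + l)))); last first.
  apply: ler_wpM2l; first by rewrite divr_ge0// subr_ge0 ltW.
  by rewrite gerBl exprn_ge0// ltW.
elim: l => [|l IHl]; first by rewrite addn0 !subrr normr0 mulr0.
rewrite addnS prefix_wordS word_map_cat/=.
set a := word_map f _ 0 in IHl *; set a1 := word_map f _ 0 in IHl *.
set a2 := word_map f _ _.
rewrite -(subrKA a1) (le_trans (ler_normD _ _))//.
have a12 : `|a1 - a2| <= b * q ^+ (m + l).
  rewrite (le_trans (norm_le_eucl _ _))// word_mapE mulrC ler_pM//.
  - exact: eucl_dist_ge0.
  - exact/ltW/word_ratio_gt0.
  - exact: (le_bigmax _ (fun i => eucl_dist 0 (f i 0))).
  - by have /andP[_] := cq (prefix_word w (m + l)); rewrite size_prefix_word.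
rewrite (le_trans (lerD IHl a12))// exprS le_eqVlt; apply/orP; left; apply/eqP.
by field; rewrite subr_eq0 gt_eqF.
Qed.

Lemma coding_cvg w :
  word_map f (prefix_word w m) 0 @[m --> \oo] --> coding f w.
Proof.
apply/cauchy_cvgP; apply/cauchy_exP => e e0.
have [D [q [D0 q0 q1 Dq]]] := word_map_cauchy.
have /cvgrPdist_lt/(_ _ e0) : D * q ^+ m @[m --> \oo] --> (0 : R).
  by rewrite -(mulr0 D); apply: cvgM; [exact: cvg_cst|apply: cvg_expr; rewrite ger0_norm ?ltW].
move=> [m _ /(_ m (leqnn m))/=]; rewrite sub0r normrN ger0_norm; last first.
  by rewrite mulr_ge0// exprn_ge0// ltW.
move=> De; exists (word_map f (prefix_word w m) 0), m => // k /= mk.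
by rewrite -ball_normE/= -(subnKC mk) (le_lt_trans (Dq _ _ _)).
Qed.

(** Dropping the first [m] terms does not change the limit, and the continuous map of the prefix
    passes through it. *)
Lemma coding_word w m :
  coding f w = word_map f (prefix_word w m) (coding f (shift_by m w)).
Proof.
have h1 := @word_map_continuous (prefix_word w m) (coding f (shift_by m w)).
have /(cvg_comp _ _ (coding_cvg (shift_by m w))) {}h1 := h1.
have h2 := cvg_comp _ _ (@cvg_addnl m) (coding_cvg w).
apply: (cvg_unique _ h2); first exact: norm_hausdorff.
rewrite /comp/=; under [in X in X --> _]eq_fun do rewrite prefix_wordD word_map_cat.
exact: h1.
Qed.

Lemma coding_bounded : exists2 D : R, 0 <= D & forall w, `|coding f w| <= D.
Proof.
have [D [q [D0 q0 q1 Dq]]] := word_map_cauchy.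
exists D => // w.
have h : `|word_map f (prefix_word w m) 0| @[m --> \oo] --> `|coding f w|.
  exact: cvg_norm (coding_cvg w).
rewrite -(cvg_lim _ h)//; apply: limr_le; first by apply/cvg_ex; eexists; exact: h.
apply: nearW => m /=; have := Dq w 0 m; rewrite /= sub0r normrN expr0 mulr1.
exact.
Qed.

(** This is the diameter bound for cylinders: both points are images, under the map of the common
    prefix, of points of a bounded set. *)
Lemma eucl_coding : exists2 D : R, 0 < D & forall w w' m,
  prefix_word w m = prefix_word w' m ->
  eucl_dist (coding f w) (coding f w') <= word_ratio rho (prefix_word w m) * D.
Proof.
have [D D0 hD] := coding_bounded.
(* The [+ 1] makes the constant positive even if [n] or [D] is 0. *)
exists (n%:R * (D + D) + 1) => [|w w' m ww'].
  by rewrite ltr_wpDl// mulr_ge0// addr_ge0.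
rewrite (coding_word w m) (coding_word w' m) -ww' word_mapE.
rewrite ler_wpM2l//; first exact/ltW/word_ratio_gt0.
rewrite ler_wpDr// (le_trans (eucl_le_norm _ _))// ler_wpM2l//.
by rewrite (le_trans (ler_normB _ _))// lerD.
Qed.

Lemma eucl_coding_base (M : R) : 0 <= M -> exists2 D : R, 0 < D &
  forall w m a, `|a| <= M ->
  eucl_dist (coding f w) (word_map f (prefix_word w m) a) <=
  word_ratio rho (prefix_word w m) * D.
Proof.
move=> M0; have [D D0 hD] := coding_bounded.
exists (n%:R * (D + M) + 1) => [|w m a aM].
  by rewrite ltr_wpDl// mulr_ge0// addr_ge0.
rewrite (coding_word w m) word_mapE ler_wpM2l//; first exact/ltW/word_ratio_gt0.
rewrite ler_wpDr// (le_trans (eucl_le_norm _ _))// ler_wpM2l//.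
by rewrite (le_trans (ler_normB _ _))// lerD.
Qed.

Lemma coding_continuous : continuous (coding f).
Proof.
move=> w; apply/(cvgrPdist_lt (FF := nbhs_filter w)) => e e0.
have [D D0 hD] := eucl_coding; have [c [q [c0 q1 q0 cq]]] := ratio_bounds.
have /cvgrPdist_lt/(_ _ e0) : q ^+ m * D @[m --> \oo] --> (0 : R).
  by rewrite -(mul0r D); apply: cvgM; [apply: cvg_expr; rewrite ger0_norm ?ltW|exact: cvg_cst].
move=> [m _ /(_ m (leqnn m))/=]; rewrite sub0r normrN ger0_norm; last first.
  by rewrite mulr_ge0 ?(ltW D0)// exprn_ge0// ltW.
move=> De; near=> w'.
apply: le_lt_trans De; apply: (le_trans (norm_le_eucl _ _)).
apply: (@le_trans _ _ (word_ratio rho (prefix_word w m) * D)).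
  by apply: hD; apply/esym; near: w'; exact: near_prefix.
rewrite ler_wpM2r ?(ltW D0)//.
by have /andP[_] := cq (prefix_word w m); rewrite size_prefix_word.
Unshelve. all: by end_near. Qed.

End Coding.

(** * Finite lists of words, and block codes *)

Section WordLists.
Context {N : nat}.
Implicit Types (S T : set (code_space N)) (w : code_space N) (u v : seq 'I_N).

(** A duplicate-free enumeration of [S^m], so that sums over [words S m] become ordinary sums over a
    sequence. *)
Definition word_list S m : seq (seq 'I_N) :=
  map (@tval m 'I_N) [seq u : m.-tuple 'I_N <- enum {: m.-tuple 'I_N} | `[< words S m (tval u) >]].

Lemma word_listP S m u : reflect (words S m u) (u \in word_list S m).
Proof.
apply: (iffP mapP) => [[v]|Su].
  by rewrite mem_filter => /andP[/asboolP Sv _] ->.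
have um : size u == m by have [w _ <-] := Su; rewrite size_prefix_word.
by exists (Tuple um) => //; rewrite mem_filter mem_enum andbT; apply/asboolP.
Qed.

Lemma word_list_uniq S m : uniq (word_list S m).
Proof. by rewrite (map_inj_uniq val_inj) filter_uniq ?enum_uniq. Qed.

Lemma fsbig_words (R : realType) S m (F : seq 'I_N -> R) :
  \sum_(u \in words S m) F u = \sum_(u <- word_list S m) F u.
Proof.
have -> : words S m = [set` word_list S m].
  by apply/seteqP; split=> u /= /word_listP.
by rewrite -fsbig_seq ?word_list_uniq.
Qed.

Definition short_words S k : seq (seq 'I_N) :=
  flatten [seq word_list S m | m <- iota 1 k].

Lemma short_wordsP S k u :
  reflect [/\ words S (size u) u, (0 < size u)%N & (size u <= k)%N]
    (u \in short_words S k).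
Proof.
apply: (iffP flatten_mapP) => [[m]|[Su u0 uk]].
  rewrite mem_iota add1n ltnS => /andP[m0 mk] /word_listP Su.
  by have [w Sw wu] := Su; rewrite -wu size_prefix_word wu.
by exists (size u); [rewrite mem_iota add1n ltnS u0|apply/word_listP].
Qed.

Definition block_codes S k : set (code_space N) :=
  [set w | forall j, words S k (prefix_word (shift_by (j * k) w) k)].

Lemma sub_block_codes S k : shift_closed S -> S `<=` block_codes S k.
Proof.
by move=> Sshift w Sw j; exists (shift_by (j * k) w) => //; exact: shift_closed_by.
Qed.

Lemma shift_block_codes S k w :
  block_codes S k w -> block_codes S k (shift_by k w).
Proof. by move=> Sw j; rewrite shift_byD -mulSn. Qed.

Lemma cat_block_codes S k u w :
  words S k u -> block_codes S k w -> block_codes S k (cat_code u w).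
Proof.
move=> Su Sw; have uk : size u = k by have [v _ <-] := Su; rewrite size_prefix_word.
case=> [|j]; first by rewrite shift_by0 -[in X in prefix_word _ X]uk
  prefix_cat_code_size.
by rewrite mulSn -shift_byD -[in shift_by k _]uk shift_cat_code.
Qed.

Lemma prefix_block_codes S k w : block_codes S k w -> words S k (prefix_word w k).
Proof. by move=> /(_ 0); rewrite shift_by0. Qed.

Lemma code_space_compact : compact [set: code_space N].
Proof.
have finI : compact [set: discrete_topology 'I_N].
  by apply: finite_compact; exact: (@finite_finset 'I_N setT).
have := @tychonoff nat (fun=> discrete_topology 'I_N) (fun=> setT) (fun=> finI).
by congr (compact _); apply/seteqP; split.
Qed.

(** Each block condition depends on a finite prefix only, and a limit code shares that prefix with
    some block code. *)
Lemma block_codes_closed S k : closed (block_codes S k).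
Proof.
move=> w clw j.
have [w' [Sw' e]] := clw _ (near_prefix w (j * k + k)).
have {}e : prefix_word w' (j * k + k) = prefix_word w (j * k + k) := e.
move: (Sw' j) e; rewrite !prefix_wordD => Sw'j /eqP.
by rewrite eqseq_cat ?size_prefix_word// => /andP[_ /eqP <-].
Qed.

Lemma block_codes_compact S k : compact (block_codes S k).
Proof. exact: subclosed_compact (@block_codes_closed S k) code_space_compact _. Qed.

End WordLists.

(** [F] accumulates, beyond its compact pieces [K], only at [A]. A point of the closure outside [F]
    avoids every closed [K], so points of [A] come arbitrarily near to it, and [A] is closed. *)
Lemma compact_accumulation {R : realType} {n : nat} (A F : set 'rV[R]_n) :
  compact A -> A `<=` F ->
  (forall e : R, 0 < e -> exists K, [/\ compact K, K `<=` F &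
     forall x, F x -> K x \/ exists2 a, A a & `|x - a| < e]) ->
  compact F.
Proof.
move=> cA AF FK; apply: bounded_closed_compact.
  have [MA [_ hMA]] := compact_bounded cA.
  have [K [cK _ KF]] := FK _ ltr01.
  have [MK [_ hMK]] := compact_bounded cK.
  exists (Num.max MA MK + 2); split; first exact: num_real.
  move=> x Mx v Fv.
  have [Kv|[a Aa va]] := KF _ Fv.
    by apply: hMK Kv; rewrite (le_lt_trans _ Mx)// ler_wpDr// le_max lexx orbT.
  have aM : `|a| <= Num.max MA MK + 1.
    by apply: hMA Aa; rewrite ltr_pwDr// le_max lexx.
  rewrite /= -(subrK a v) (le_trans (ler_normD _ _))//. lra.
move=> p clp; have [//|Fp] := pselect (F p); apply: AF.
have hA : closed A by apply: compact_closed => //; exact: norm_hausdorff.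
apply: hA => B /nbhs_ballP[e/= e0 eB].
have [K [cK KF hK]] := FK _ (divr_gt0 e0 (ltr0n _ 2)).
have [Kp|Kp] := pselect (K p); first by have := Fp (KF _ Kp).
have oK : open (~` K).
  by apply: closed_openC; apply: compact_closed => //; exact: norm_hausdorff.
have [x [Fx [Kx px]]] := clp _ (filterI (open_nbhs_nbhs (conj oK Kp))
  (nbhsx_ballx p _ (divr_gt0 e0 (ltr0n _ 2)))).
have [//|[a Aa xa]] := hK _ Fx.
exists a; split => //; apply: eB; rewrite -ball_normE/=.
move: px; rewrite -ball_normE/= => px.
rewrite -(subrKA x) (le_lt_trans (ler_normD _ _))//.
have := ltrD px xa; lra.
Qed.

(** * The systems [I_k], the sets [E_k] and the orbital set *)

Section BlockSystem.
Context {R : realType} {n N : nat}.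
Variables (f : 'I_N -> 'rV[R]_n -> 'rV[R]_n) (rho : 'I_N -> R).
Hypothesis hf : forall i, contracting_similarity (f i) (rho i).
Variables (S : set (code_space N)) (k : nat).
Hypotheses (S0 : S !=set0) (Sshift : shift_closed S) (k0 : (0 < k)%N).

Definition block_ifs (j : 'I_(size (short_words S k))) : 'rV[R]_n -> 'rV[R]_n :=
  word_map f (nth [::] (short_words S k) j).

Definition block_set : set 'rV[R]_n := coding f @` block_codes S k.

Lemma block_ifsP u : u \in short_words S k -> exists j, block_ifs j = word_map f u.
Proof.
move=> Su; have uk : (index u (short_words S k) < size (short_words S k))%N.
  by rewrite index_mem.
by exists (Ordinal uk); rewrite /block_ifs/= nth_index.
Qed.

Lemma block_ifs_IFS : is_IFS block_ifs.
Proof.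
move=> j; exists (word_ratio rho (nth [::] (short_words S k) j)).
apply: word_similarity => //.
by have /short_wordsP[] : nth [::] (short_words S k) j \in short_words S k
  by exact: mem_nth.
Qed.

Lemma coding_image_sub_block_set : coding f @` S `<=` block_set.
Proof. by apply: image_subset; exact: sub_block_codes. Qed.

Lemma block_set_nonempty : block_set !=set0.
Proof.
have [w Sw] := S0; exists (coding f w); apply: coding_image_sub_block_set.
by exists w.
Qed.

Lemma block_set_compact : compact block_set.
Proof.
apply: continuous_compact; last exact: block_codes_compact.
by apply: continuous_subspaceT; exact: coding_continuous hf.
Qed.

Lemma block_set_sub : block_set `<=` \bigcup_j (block_ifs j @` block_set).
Proof.
move=> _ [w Sw <-]; rewrite (coding_word _ _ hf w k).
have Swk := prefix_block_codes _ _ _ Sw.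
have [|j jE] := block_ifsP (prefix_word w k).
  by apply/short_wordsP; rewrite size_prefix_word.
exists j => //; rewrite jE; exists (coding f (shift_by k w)) => //.
by exists (shift_by k w) => //; exact: shift_block_codes.
Qed.

Lemma block_set_sss : sub_self_similar block_ifs block_set.
Proof.
split; [exact: block_set_nonempty|exact: block_set_compact|exact: block_set_sub].
Qed.

(** The copies of [C] accumulate only at [block_set]: along a long word [u], the copy is uniformly
    close to the point coded by any code of [S] starting with [u]. The finitely many short words
    contribute a compact set. *)
Lemma orbital_set_compact (C : set 'rV[R]_n) : compact C ->
  compact (block_set `|` orbital_set f S C).
Proof.
move=> cC; apply: (compact_accumulation block_set) => //.
  exact: block_set_compact.
move=> e e0.
have [M [_ /(_ (`|M| + 1))]] := compact_bounded cC.
rewrite (le_lt_trans (ler_norm M)) ?ltrDl// => /(_ isT) hM.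
have M0 : 0 <= `|M| + 1 by rewrite addr_ge0.
have [D D0 hD] := eucl_coding_base _ _ hf _ M0.
have [c [q [c0 q1 q0 cq]]] := ratio_bounds _ _ hf.
have /cvgrPdist_lt/(_ _ e0) : q ^+ m * D @[m --> \oo] --> (0 : R).
  rewrite -(mul0r D); apply: cvgM; last exact: cvg_cst.
  by apply: cvg_expr; rewrite ger0_norm ?ltW.
move=> [m _ hm].
exists (C `|` \big[setU/set0]_(u <- short_words S m) (word_map f u @` C)); split.
- apply: compactU => //; apply: bigsetU_compact => u _.
  apply: continuous_compact => //.
  by apply: continuous_subspaceT; exact: word_map_continuous hf _.
- apply: subset_trans (@subsetUr _ _ _); apply: setUS.
  rewrite -bigcup_seq; apply: bigcup_sub => u /= /short_wordsP[Su u0 _] x ux.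
  by exists u => //; exists (size u).
- move=> x [|[Cx|[u [l /= l0 Su] [y Cy <-]]]].
  + by move=> Ax; right; exists x; rewrite // subrr normr0.
  + by left; left.
  + have [w Sw wu] := Su.
    have ul : size u = l by rewrite -wu size_prefix_word.
    have [lm|ml] := leqP l m.
      left; right; rewrite -bigcup_seq; exists u; last by exists y.
      by apply/short_wordsP; rewrite ul.
    right; exists (coding f w).
      by apply: coding_image_sub_block_set; exists w.
    rewrite distrC -wu (le_lt_trans (norm_le_eucl _ _))//.
    rewrite (le_lt_trans (hD _ _ _ (hM _ Cy)))//.
    have := hm _ (ltnW ml); rewrite /= sub0r normrN ger0_norm; last first.
      by rewrite mulr_ge0 ?(ltW D0)// exprn_ge0// ltW.
    apply: le_lt_trans; rewrite ler_wpM2r ?(ltW D0)//.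
    by have /andP[_] := cq (prefix_word w l); rewrite size_prefix_word.
Qed.

(** A word of length at most [k] is itself the word of a map of the system, applied to [C]. A longer
    one is cut after [k] letters, and shift closure keeps the remainder in [S^*]. *)
Lemma orbital_set_sub (C : set 'rV[R]_n) :
  orbital_set f S C `<=`
  (\bigcup_j (block_ifs j @` orbital_set f S C)) `|` C.
Proof.
move=> x [Cx|[u [l /= l0 Su] [y Cy <-]]]; first by right.
have [w Sw wu] := Su.
left; have [lk|kl] := leqP l k.
  have [|j jE] := block_ifsP u.
    by apply/short_wordsP; rewrite -wu size_prefix_word wu.
  by exists j => //; exists y; [left|rewrite jE].
have [|j jE] := block_ifsP (prefix_word w k).
  by apply/short_wordsP; rewrite size_prefix_word; split=> //; exists w.
rewrite -wu -(subnKC (ltnW kl)) prefix_wordD word_map_cat.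
exists j => //; rewrite jE.
exists (word_map f (prefix_word (shift_by k w) (l - k)) y) => //.
right; exists (prefix_word (shift_by k w) (l - k)); last by exists y.
exists (l - k)%N; first by rewrite /= subn_gt0.
by exists (shift_by k w) => //; exact: shift_closed_by.
Qed.

Lemma block_set_isss (C : set 'rV[R]_n) : compact C ->
  inhom_sub_self_similar block_ifs C (block_set `|` orbital_set f S C).
Proof.
move=> cC; split.
- by have [x Ax] := block_set_nonempty; exists x; left.
- exact: orbital_set_compact.
- move=> x [/block_set_sub|/orbital_set_sub].
    by move=> [j _ [y Ay <-]]; left; exists j => //; exists y => //; left.
  move=> [[j _ [y Ay <-]]|]; last by right.
  by left; exists j => //; exists y => //; right.
Qed.

End BlockSystem.

(** * Hausdorff measure and dimension: null sets and their covers *)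

Section HausdorffDimensionTheory.
Context {R : realType} {n : nat}.
Implicit Types (A B : set 'rV[R]_n) (s t delta : R).

Lemma diam_ge0 A : A !=set0 -> (0 <= diam A)%E.
Proof.
move=> [x Ax]; apply: ereal_sup_ubound; exists x, x; split=> //.
by rewrite eucl_distxx.
Qed.

Lemma eucl_le_diam A x y : A x -> A y -> ((eucl_dist x y)%:E <= diam A)%E.
Proof. by move=> Ax Ay; apply: ereal_sup_ubound; exists x, y. Qed.

Lemma diam_pow_ge0 s A : (0 <= diam_pow s A)%E.
Proof. by rewrite /diam_pow; case: ifP => // _; exact: poweR_ge0. Qed.

Lemma diam_pow_le s A d : 0 <= s -> (diam A <= d%:E)%E ->
  (diam_pow s A <= (d `^ s)%:E)%E.
Proof.
move=> s0 Ad; rewrite /diam_pow; case: ifPn => [_|/set0P A0].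
  by rewrite lee_fin powR_ge0.
have dA := diam_ge0 _ A0.
rewrite -poweR_EFin gt0_ler_poweR// in_itv/= ?leey ?andbT//.
exact: le_trans Ad.
Qed.

Lemma hausdorff_pre_ge0 s delta A : (0 <= hausdorff_pre s delta A)%E.
Proof.
apply: le_ereal_inf_tmp => _ [U _ <-].
by apply: nneseries_ge0 => i _ _; exact: diam_pow_ge0.
Qed.

Lemma hausdorff_measure_eq0 s A : hausdorff_measure s A = 0%E <->
  forall delta, 0 < delta -> hausdorff_pre s delta A = 0%E.
Proof.
split=> [A0 delta d0|A0].
  apply/eqP; rewrite eq_le hausdorff_pre_ge0 andbT -A0.
  by apply: ereal_sup_ubound; exists delta.
apply/eqP; rewrite eq_le; apply/andP; split.
  by apply: ge_ereal_sup => _ [delta /= /A0 -> <-].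
by rewrite -(A0 1)//; apply: ereal_sup_ubound; exists 1 => /=.
Qed.

Lemma hausdorff_measure0_sub s A B : A `<=` B ->
  hausdorff_measure s B = 0%E -> hausdorff_measure s A = 0%E.
Proof.
move=> AB /hausdorff_measure_eq0 B0; apply/hausdorff_measure_eq0 => d d0.
apply/eqP; rewrite eq_le hausdorff_pre_ge0 andbT -(B0 _ d0).
apply: ereal_inf_le_tmp; apply: image_subset => U [BU dU]; split=> //.
exact: subset_trans BU.
Qed.

Lemma hausdorff_dim_ge0 A : (0 <= hausdorff_dim A)%E.
Proof. by apply: le_ereal_inf_tmp => _ [s [s0 _] <-]; rewrite lee_fin. Qed.

Lemma hausdorff_dim_le t A : 0 <= t -> hausdorff_measure t A = 0%E ->
  (hausdorff_dim A <= t%:E)%E.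
Proof. by move=> t0 At; apply: ereal_inf_lbound; exists t. Qed.

Lemma hausdorff_dim_mono A B : A `<=` B -> (hausdorff_dim A <= hausdorff_dim B)%E.
Proof.
move=> AB; apply: ereal_inf_le_tmp; apply: image_subset => s [s0 sB]; split=> //.
exact: hausdorff_measure0_sub sB.
Qed.

Lemma hausdorff_measure0_cover t A e : hausdorff_measure t A = 0%E -> 0 < e ->
  exists2 U : nat -> set 'rV[R]_n, A `<=` \bigcup_i U i &
    (\sum_(0 <= i <oo) diam_pow t (U i) < e%:E)%E.
Proof.
move=> /hausdorff_measure_eq0/(_ 1 ltr01) At e0.
have : (hausdorff_pre t 1 A < e%:E)%E by rewrite At lte_fin.
by move=> /ereal_inf_lt[_ [U [AU _] <-] Ue]; exists U.
Qed.

(** The infimum provides some [s < t]. The case [s = 0] is impossible: a cover of a non-empty set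
    has a non-empty member, which already contributes 1. *)
Lemma hausdorff_dim_lt t A : A !=set0 -> (hausdorff_dim A < t%:E)%E ->
  exists s, [/\ 0 < s, s < t & hausdorff_measure s A = 0%E].
Proof.
move=> [x Ax] /ereal_inf_lt[_ [s [s0 sA] <-]]; rewrite lte_fin => st.
exists s; split=> //; rewrite lt_neqAle s0 andbT; apply/eqP => s_eq0.
have [U AU] := hausdorff_measure0_cover _ _ 1 sA ltr01.
rewrite ltNge => /negP; apply.
have [i _ Uix] := AU _ Ax.
have Ui : U i !=set0 by exists x.
apply: le_trans (nneseries_lim_ge i.+1 _); last first.
  by move=> j _ _; exact: diam_pow_ge0.
rewrite big_nat_recr//= -[leLHS]add0e leeD//.
  by apply: sume_ge0 => j _; exact: diam_pow_ge0.
rewrite /diam_pow; have /set0P/negbTE -> := Ui.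
by rewrite -s_eq0 poweRe0.
Qed.

(** Upper bounds [p.2] on diameters suffice, and a finite list becomes a countable cover by padding
    with empty sets, whose contribution is 0. *)
Lemma hausdorff_measure0_le t A : 0 <= t ->
  (forall e, 0 < e -> exists L : seq (set 'rV[R]_n * R),
     [/\ forall x, A x -> exists2 p, p \in L & p.1 x,
         forall p, p \in L -> (diam p.1 <= p.2%:E)%E /\ p.2 <= e &
         \sum_(p <- L) p.2 `^ t <= e]) ->
  hausdorff_measure t A = 0%E.
Proof.
move=> t0 AL; apply/hausdorff_measure_eq0 => d d0.
apply/eqP; rewrite eq_le hausdorff_pre_ge0 andbT; apply/lee_addgt0Pr => e e0.
rewrite add0e; have de0 : 0 < Num.min d e by rewrite lt_min d0.
have [L [AcovL dL sumL]] := AL _ de0.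
pose U i := (nth (set0, 0) L i).1.
apply: (@le_trans _ _ (\sum_(0 <= i <oo) diam_pow t (U i))%E).
  apply: ereal_inf_lbound; exists U => //; split.
    move=> x /AcovL[p pL px]; exists (index p L) => //.
    by rewrite /U nth_index.
  move=> i; rewrite /U; have [iL|Li] := ltnP i (size L).
    have [diL dLi] := dL _ (mem_nth (set0, 0) iL).
    rewrite (le_trans diL)// lee_fin (le_trans dLi)//.
    by rewrite ge_min lexx.
  rewrite nth_default//; apply: ge_ereal_sup => _ [x [y []]] //.
apply: (@le_trans _ _ (\sum_(p <- L) p.2 `^ t)%:E); last first.
  by rewrite lee_fin (le_trans sumL)// ge_min lexx orbT.
apply: lime_le; first by apply: is_cvg_nneseries => i _ _; exact: diam_pow_ge0.
exists (size L) => // m /= Lm.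
rewrite (big_cat_nat (leq0n _) Lm)/= [X in (_ + X)%E]big1_seq ?adde0; last first.
  move=> i /andP[_]; rewrite mem_index_iota => /andP[Li _].
  by rewrite /U nth_default// /diam_pow eqxx.
rewrite (big_nth (set0, 0)) -sumEFin big_seq [leRHS]big_seq.
apply: lee_sum => i; rewrite mem_index_iota => /andP[_ iL].
apply: diam_pow_le => //.
by have [] := dL _ (mem_nth (set0, 0) iL).
Qed.

(* Blow each covering set up to a ball whose radius has only slightly larger
   t-th power; compactness then leaves finitely many balls. *)
Lemma hausdorff_measure0_balls t A e : compact A -> 0 < t ->
  hausdorff_measure t A = 0%E -> 0 < e ->
  exists L : seq ('rV[R]_n * R),
    [/\ forall p, p \in L -> 0 < p.2,
        forall x, A x -> exists2 p, p \in L & `|p.1 - x| < p.2 &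
        \sum_(p <- L) p.2 `^ t <= e].
Proof.
move=> cA t0 At e0.
have e2 : 0 < e / 2 by rewrite divr_gt0.
have [U AU Ue] := hausdorff_measure0_cover _ _ _ At e2.
have partial m : (\sum_(0 <= i < m) diam_pow t (U i) < (e / 2)%:E)%E.
  apply: le_lt_trans Ue; apply: nneseries_lim_ge => j _ _.
  exact: diam_pow_ge0.
have diam_fin i : diam_pow t (U i) \is a fin_num.
  rewrite ge0_fin_numE ?diam_pow_ge0//; apply: lt_trans (ltry (e / 2)).
  apply: le_lt_trans (partial i.+1).
  rewrite big_nat_recr//= -[leLHS]add0e leeD//.
  by apply: sume_ge0 => j _; exact: diam_pow_ge0.
(* The surplus makes [b i] positive even for a set of diameter 0, and all the surpluses together
   stay below [e / 2]. *)
pose b i : R := fine (diam_pow t (U i)) + e / 2 * 2^-1 ^+ i.+1.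
have b0 i : 0 < b i.
  rewrite /b ltr_wpDl//; first by rewrite fine_ge0// diam_pow_ge0.
  by rewrite mulr_gt0// exprn_gt0// invr_gt0.
pose d i := b i `^ t^-1.
have d0 i : 0 < d i by rewrite /d powR_gt0.
have dt i : d i `^ t = b i.
  by rewrite /d -powRrM mulVf ?gt_eqF// powRr1// ltW.
pose x i := xget 0 (U i).
have : cover_compact A by rewrite -compact_cover.
move=> /(_ _ [set: nat] (fun i => ball (x i) (d i))).
case=> [i _||D' _ AD'].
- exact: ball_open.
- move=> y /AU[i _ Uiy]; exists i => //; rewrite -ball_normE/=.
  have Uix : U i (x i) by apply: (xgetPex 0); exists y.
  apply: le_lt_trans (norm_le_eucl _ _) _.
  have := eucl_le_diam _ _ _ Uix Uiy.
  have Ui0 : U i !=set0 by exists y.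
  (* A point of [U i] outside the ball would force [diam (U i)] to be at least [d i], hence its
     power to be at least [b i], which exceeds it. *)
  move=> dle; rewrite ltNge; apply/negP => dlt.
  have : ((b i)%:E <= diam_pow t (U i))%E.
    rewrite -dt /diam_pow; have /set0P/negbTE -> := Ui0.
    rewrite -poweR_EFin; apply: gt0_ler_poweR; first exact: ltW.
    + by rewrite in_itv/= leey andbT lee_fin ltW.
    + by rewrite in_itv/= leey andbT; exact: diam_ge0.
    + by apply: le_trans dle; rewrite lee_fin.
  rewrite -(fineK (diam_fin i)) lee_fin /b gerDl leNgt => /negP; apply.
  by rewrite mulr_gt0// exprn_gt0// invr_gt0.
have [m hm] : exists m, forall i, i \in finmap.enum_fset D' -> (i < m)%N.
  exists (\max_(i <- finmap.enum_fset D') i).+1 => i D'i.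
  by rewrite ltnS; exact: (@leq_bigmax_seq _ _ xpredT id).
exists [seq (x i, d i) | i <- index_iota 0 m]; split.
- by move=> p /mapP[i _ ->]; exact: d0.
- move=> y /AD'[i D'i]; rewrite -ball_normE => yi.
  exists (x i, d i); last exact: yi.
  by apply: (@map_f _ _ (fun i => (x i, d i))); rewrite mem_index_iota hm.
- rewrite big_map/=; under eq_bigr do rewrite dt.
  rewrite big_split/= [leRHS](splitr e); apply: lerD.
    rewrite -lee_fin -sumEFin; under eq_bigr do rewrite fineK//.
    exact/ltW/partial.
  rewrite -mulr_sumr ler_piMr ?(ltW e2)//.
  suff -> : \sum_(0 <= i < m) (2^-1 : R) ^+ i.+1 = 1 - 2^-1 ^+ m.
    by rewrite gerBl exprn_ge0.
  clear hm; elim: m => [|l IHl]; first by rewrite big_geq// expr0 subrr.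
  by rewrite big_nat_recr//= IHl exprS; field.
Qed.

End HausdorffDimensionTheory.

(** * Two counting tools: sums over sublists, and separated points in a ball *)

Lemma ler_sum_subset {R : numDomainType} {T : eqType} (s s' : seq T) (F : T -> R) :
  uniq s -> {subset s <= s'} -> (forall x, 0 <= F x) ->
  \sum_(x <- s) F x <= \sum_(x <- s') F x.
Proof.
move=> us ss' F0; elim: s s' us ss' => [|x s IHs] s' /= us ss'.
  by rewrite big_nil sumr_ge0.
have /andP[xs {}us] := us.
rewrite big_cons [leRHS](big_rem x) ?ss' ?mem_head//= lerD2l; apply: IHs => // y ys.
apply: rem_mem; last by apply: ss'; rewrite inE ys orbT.
by apply: contraNneq xs => <-.
Qed.

(* Distinct points of a separated family lie in distinct cells of a grid of
   comparable mesh. *)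
Lemma separated_bounded {R : realType} {n : nat} (M e : R) : 0 <= M -> 0 < e ->
  exists K : nat, forall (d : R) (x : 'rV[R]_n) (L : seq 'rV[R]_n),
    0 < d -> uniq L -> (forall y, y \in L -> `|y - x| <= M * d) ->
    (forall y z, y \in L -> z \in L -> y != z -> e * d <= eucl_dist y z) ->
    (size L <= K)%N.
Proof.
(* The quotient of the width [2 * M * d] by the mesh [e * d / n.+1], from which [d] cancels, bounds
   the cell indices in each direction. *)
move=> M0 e0; pose m := Num.truncn (2 * M * n.+1%:R / e).
exists #|{ffun 'I_n -> 'I_m.+1}| => d x L d0 uL LM Le.
pose h := e * d / n.+1%:R.
have h0 : 0 < h by rewrite divr_gt0 ?mulr_gt0.
pose c (y : 'rV[R]_n) i := (y ord0 i - x ord0 i + M * d) / h.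
have cge0 y i : y \in L -> 0 <= c y i.
  move=> yL; rewrite divr_ge0 ?(ltW h0)//.
  have := le_trans (coord_le_norm (y - x) i) (LM _ yL).
  by rewrite !mxE ler_norml => /andP[]; lra.
have cle y i : y \in L -> c y i <= 2 * M * n.+1%:R / e.
  move=> yL; rewrite /c ler_pdivrMr//.
  have -> : 2 * M * n.+1%:R / e * h = 2 * M * d.
    by rewrite /h; field; rewrite addrC natr1 pnatr_eq0 (gt_eqF e0).
  have := le_trans (coord_le_norm (y - x) i) (LM _ yL).
  by rewrite !mxE ler_norml => /andP[_]; lra.
pose cell y : {ffun 'I_n -> 'I_m.+1} := [ffun i => inord (Num.truncn (c y i))].
have cell_inj : {in L &, injective cell}.
  move=> y z yL zL yz; apply/eqP; apply: contraT => yNz.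
  have := Le _ _ yL zL yNz; rewrite leNgt => /negP[].
  (* Points of one cell differ by at most [h] in each coordinate; dividing by [n.+1] makes
     [n * h < e * d] strict and covers [n = 0]. *)
  apply: (@le_lt_trans _ _ (n%:R * h)); last first.
    by rewrite /h mulrCA gtr_pMr ?mulr_gt0// ltr_pdivrMr// mul1r ltr_nat.
  apply: eucl_le_coord => [|i]; first exact: ltW.
  have /ffunP/(_ i) := yz; rewrite !ffunE => /(congr1 val)/=; rewrite !inordK ?ltnS.
  - move=> tyz.
    have /andP[y1 y2] := truncn_itv (cge0 y i yL).
    have /andP[z1 z2] := truncn_itv (cge0 z i zL).
    rewrite tyz in y1 y2.
    have -> : y ord0 i - z ord0 i = (c y i - c z i) * h.
      by rewrite /c; field; rewrite gt_eqF.
    rewrite normrM (gtr0_norm h0) ler_piMl ?(ltW h0)// ler_norml.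
    by move: y1 y2 z1 z2; rewrite -natr1; lra.
  - by apply: le_truncn; exact: cle.
  - by apply: le_truncn; exact: cle.
rewrite -(size_map cell) -(card_uniqP _) ?max_card//.
by rewrite map_inj_in_uniq.
Qed.

(** * Stopping words and counting under the open set condition *)

Section OpenSetCondition.
Context {R : realType} {n N : nat}.
Variables (f : 'I_N -> 'rV[R]_n -> 'rV[R]_n) (rho : 'I_N -> R).
Hypothesis hf : forall i, contracting_similarity (f i) (rho i).
Implicit Types (w : code_space N) (u v : seq 'I_N).
Variable U : set 'rV[R]_n.
Hypothesis oU : open U.
Hypothesis U0 : U !=set0.
Hypothesis fU : \bigcup_i (f i @` U) `<=` U.
Hypothesis dU : forall i j, i != j -> (f i @` U) `&` (f j @` U) = set0.

Lemma word_map_open_sub u x : U x -> U (word_map f u x).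
Proof.
move=> Ux; elim: u => //= i u Uu; apply: fU; exists i => //; exact: imageP.
Qed.

(** Injectivity cancels the common prefix; at the first differing letters the points lie in disjoint
    images of [U]. *)
Lemma word_map_disjoint u v x y : ~~ prefix u v -> ~~ prefix v u ->
  U x -> U y -> word_map f u x != word_map f v y.
Proof.
elim: u v => [|i u IHu] [|j v]//=.
have [<-|ij] := eqVneq i j.
  move=> uv vu Ux Uy; apply: contra (IHu _ uv vu Ux Uy) => /eqP.
  by move=> /(word_map_inj _ _ hf [:: i]) /eqP.
move=> _ _ Ux Uy; apply/eqP => e.
have : ((f i @` U) `&` (f j @` U)) (f i (word_map f u x)).
  split; first by exists (word_map f u x) => //; exact: word_map_open_sub.
  by rewrite e; exists (word_map f v y) => //; exact: word_map_open_sub.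
by rewrite dU.
Qed.

(** By surjectivity [word_map f v a] is the image under [word_map f u] of some [z]. Were the
    distance smaller, [z] would be within [r] of [a], hence in [U], and incomparable words would
    have meeting images of [U]. *)
Lemma word_map_separated (a : 'rV[R]_n) (r : R) :
  (forall z, `|a - z| < r -> U z) -> 0 < r -> forall u v,
  ~~ prefix u v -> ~~ prefix v u ->
  word_ratio rho u * r <= eucl_dist (word_map f u a) (word_map f v a).
Proof.
move=> aU r0 u v uv vu; rewrite leNgt; apply/negP.
have [z zE] := word_map_surj _ _ hf u (word_map f v a).
rewrite -zE (word_mapE _ _ hf) ltr_pM2l ?(word_ratio_gt0 _ _ hf)// => az.
have Uz : U z by apply: aU; apply: le_lt_trans (norm_le_eucl _ _) az.
have Ua : U a by apply: aU; rewrite subrr normr0.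
by have := word_map_disjoint _ _ _ _ uv vu Uz Ua; rewrite zE eqxx.
Qed.

Variable p : nat.
Hypothesis p0 : (0 < p)%N.

(* The stopping words at scale [d]: the shortest prefixes, among those whose
   length is a multiple of [p], at which the ratio drops to at most [d]. *)
Definition stopping (d : R) u : Prop :=
  [/\ (p %| size u)%N, word_ratio rho u <= d &
      forall j, (j * p < size u)%N -> d < word_ratio rho (take (j * p) u)].

Lemma stopping_exists d w : 0 < d ->
  exists m, stopping d (prefix_word w (m * p)).
Proof.
move=> d0; have [c [q [c0 q1 q0 cq]]] := ratio_bounds _ _ hf.
have exm : exists m, word_ratio rho (prefix_word w (m * p)) <= d.
  have : q ^+ m @[m --> \oo] --> (0 : R) by apply: cvg_expr; rewrite gtr0_norm.
  move=> /cvgrPdist_lt/(_ _ d0)[m _ /(_ m (leqnn m))/=].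
  rewrite sub0r normrN ger0_norm ?exprn_ge0 ?(ltW q0)// => qd.
  exists m; have /andP[_] := cq (prefix_word w (m * p)).
  rewrite size_prefix_word => /le_trans; apply; apply: le_trans (ltW qd).
  by rewrite ler_wiXn2l ?ltW// leq_pmulr.
case: (ex_minnP exm) => m md mmin; exists m; split=> //.
- by rewrite size_prefix_word dvdn_mull.
- move=> j; rewrite size_prefix_word => jm.
  rewrite take_prefix_word ?(ltnW jm)// ltNge; apply/negP => /mmin.
  by rewrite leqNgt; move: jm; rewrite ltn_pmul2r// => ->.
Qed.

Lemma stopping_size_gt0 d u : d < 1 -> stopping d u -> (0 < size u)%N.
Proof.
move=> d1 [_ ud _]; rewrite lt0n; apply/negP => /nilP u0.
by move: ud; rewrite u0 /word_ratio big_nil leNgt d1.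
Qed.

(** Before its last block of [p] letters the word still has ratio above [d], and one block costs a
    factor of at least [c ^+ p]. *)
Lemma stopping_ratio_gt c d u : 0 < c -> 0 < d -> d < 1 ->
  (forall v, c ^+ size v <= word_ratio rho v) ->
  stopping d u -> c ^+ p * d <= word_ratio rho u.
Proof.
move=> c0 d0 d1 hc us; have uS := stopping_size_gt0 _ _ d1 us.
have [/dvdnP[m mE] _ hu] := us.
case: m mE => [|m] mE; first by rewrite mE mul0n in uS.
have mu : (m * p < size u)%N by rewrite mE ltn_pmul2r.
rewrite -(cat_take_drop (m * p) u) word_ratio_cat mulrC ler_pM//.
- exact: ltW.
- exact/exprn_ge0/ltW.
- exact/ltW/hu.
- by apply: le_trans (hc _); rewrite size_drop mE mulSn addnK.
Qed.

(** If [u] were a proper prefix, minimality of [v] would force the ratio of [u] above [d]. *)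
Lemma stopping_prefix d u v : stopping d u -> stopping d v -> prefix u v -> u = v.
Proof.
move=> [pu ud _] [_ _ hv] /prefixP[s vE].
have [s0|sN] := eqVneq s [::]; first by rewrite vE s0 cats0.
have := hv (size u %/ p)%N; rewrite divnK// vE take_size_cat// size_cat.
rewrite -[X in (X < _)%N]addn0 ltn_add2l lt0n size_eq0 sN => /(_ isT).
by rewrite ltNge ud.
Qed.

(** Fix [a] in [U]. Its images under the stopping words whose cylinders meet the ball are
    [c ^+ p * r * d] apart and within [(D + 1) * d] of [x], so their number is bounded independently
    of [x] and [d]. *)
Lemma ball_stopping_words : exists K : nat, forall (x : 'rV[R]_n) (d : R),
  0 < d -> d < 1 -> exists Q : seq (seq 'I_N),
  [/\ (size Q <= K)%N,
      forall u, u \in Q -> [/\ (p %| size u)%N, (0 < size u)%N &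
        word_ratio rho u <= d] &
      forall w, `|x - coding f w| < d ->
        exists2 u, u \in Q & prefix_word w (size u) = u].
Proof.
have [a Ua] := U0.
have [r /= r0 arU] := (nbhs_ballP _ _).1 (open_nbhs_nbhs (conj oU Ua)).
have aU z : `|a - z| < r -> U z by move=> az; apply: arU; rewrite -ball_normE.
have [c [q [c0 q1 q0 cq]]] := ratio_bounds _ _ hf.
have cr v : c ^+ size v <= word_ratio rho v by have /andP[] := cq v.
have [D D0 hD] := eucl_coding_base _ _ hf _ (normr_ge0 a).
have M0 : 0 <= D + 1 by rewrite addr_ge0// ltW.
have e0 : 0 < c ^+ p * r by rewrite mulr_gt0// exprn_gt0.
have [K hK] := @separated_bounded R n _ _ M0 e0.
exists K => x d d0 d1.
have cd0 : 0 < c ^+ p * d by rewrite mulr_gt0// exprn_gt0.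
(* Ratios of stopping words are at least [c ^+ p * d] and at most [q ^+ size u], so lengths are
   bounded and [Q] can be filtered from a finite list. *)
have [L hL] : exists L : nat, forall u, stopping d u -> (size u <= L)%N.
  have : q ^+ m @[m --> \oo] --> (0 : R) by apply: cvg_expr; rewrite gtr0_norm.
  move=> /cvgrPdist_lt/(_ _ cd0)[m _ /(_ m (leqnn m))/=].
  rewrite sub0r normrN ger0_norm ?exprn_ge0 ?(ltW q0)// => qd.
  exists m => u us; rewrite leqNgt; apply/negP => mu.
  have := stopping_ratio_gt _ _ _ c0 d0 d1 cr us; rewrite leNgt => /negP[].
  have /andP[_ /le_lt_trans] := cq u; apply; apply: le_lt_trans qd.
  by rewrite ler_wiXn2l ?(ltW q0) ?(ltW q1) ?(ltnW mu).
pose P u := exists w,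
  [/\ `|x - coding f w| < d, prefix_word w (size u) = u & stopping d u].
pose Q := undup [seq u <- short_words [set: code_space N] L | `[< P u >]].
have QP u : u \in Q -> P u.
  by rewrite mem_undup mem_filter => /andP[/asboolP].
exists Q; split.
- have incomp u v : u \in Q -> v \in Q -> u != v -> ~~ prefix u v.
    move=> /QP[_ [_ _ us]] /QP[_ [_ _ vs]]; apply: contraNN => uv.
    exact/eqP/(stopping_prefix _ _ _ us vs).
  have sep u v : u \in Q -> v \in Q -> u != v ->
      c ^+ p * r * d <= eucl_dist (word_map f u a) (word_map f v a).
    move=> uQ vQ uv; have vu : v != u by rewrite eq_sym.
    apply: le_trans (word_map_separated _ _ aU r0 _ _ (incomp _ _ uQ vQ uv)
      (incomp _ _ vQ uQ vu)).
    rewrite mulrAC ler_wpM2r ?(ltW r0)//.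
    by have [_ [_ _ us]] := QP _ uQ; exact: stopping_ratio_gt us.
  rewrite -(size_map (fun u => word_map f u a)); apply: (hK d x) => //.
  + rewrite map_inj_in_uniq ?undup_uniq// => u v uQ vQ e.
    apply/eqP; apply: contraT => uv; have := sep _ _ uQ vQ uv.
    by rewrite e eucl_distxx leNgt mulr_gt0.
  + move=> _ /mapP[u uQ ->]; have [w [xw wu [_ ud _]]] := QP _ uQ.
    rewrite -(subrKA (coding f w)) (le_trans (ler_normD _ _))// mulrDl mul1r.
    apply: lerD; last by rewrite distrC ltW.
    rewrite distrC (le_trans (norm_le_eucl _ _))//.
    have := hD w (size u) a (lexx _); rewrite wu => /le_trans; apply.
    by rewrite mulrC ler_wpM2l// ltW.
  + move=> _ _ /mapP[u uQ ->] /mapP[v vQ ->] uv; apply: sep => //.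
    by apply: contraNneq uv => ->.
- move=> u /QP[w [_ _ us]]; have [pu ud _] := us; split=> //.
  exact: stopping_size_gt0 d1 us.
- move=> w xw; have [m ms] := stopping_exists _ w d0.
  exists (prefix_word w (m * p)); last by rewrite size_prefix_word.
  rewrite mem_undup mem_filter; apply/andP; split.
    by apply/asboolP; exists w; rewrite size_prefix_word.
  apply/short_wordsP; split.
  + by rewrite size_prefix_word; exists w.
  + exact: stopping_size_gt0 d1 ms.
  + exact: hL.
Qed.

Lemma stopping_cover (A : set (code_space N)) t :
  compact (coding f @` A) -> 0 < t ->
  hausdorff_measure t (coding f @` A) = 0%E ->
  exists Q : seq (seq 'I_N),
  [/\ forall u, u \in Q -> (p %| size u)%N /\ (0 < size u)%N,
      forall w, A w -> exists2 u, u \in Q & prefix_word w (size u) = u &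
      \sum_(u <- Q) word_ratio rho u `^ t <= 1].
Proof.
move=> cA t0 At; have [K hK] := ball_stopping_words.
(* This bound on the ball sum forces all radii below 1, also for [K = 0], and survives
   multiplication by the at most [K] words per ball. *)
have e0 : 0 < K.+2%:R^-1 :> R by rewrite invr_gt0.
have [L [L0 AL sumL]] := hausdorff_measure0_balls _ _ _ cA t0 At e0.
have L1 b : b \in L -> b.2 < 1.
  move=> bL; rewrite ltNge; apply/negP => b1.
  have : b.2 `^ t <= K.+2%:R^-1.
    apply: le_trans sumL; rewrite (big_rem b)//= lerDl sumr_ge0// => i _.
    exact: powR_ge0.
  apply/negP; rewrite -ltNge (@lt_le_trans _ _ 1) ?invf_lt1 ?ltr1n//.
  by have := ler_powR b1 (ltW t0); rewrite powRr0.
suff [Q [Qsize Qcov Qsum]] : exists Q : seq (seq 'I_N),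
  [/\ forall u, u \in Q -> (p %| size u)%N /\ (0 < size u)%N,
      forall w b, b \in L -> `|b.1 - coding f w| < b.2 ->
        exists2 u, u \in Q & prefix_word w (size u) = u &
      \sum_(u <- Q) word_ratio rho u `^ t <= K%:R * \sum_(b <- L) b.2 `^ t].
  exists Q; split=> // [w Aw|].
    have [|b bL wb] := AL (coding f w); first by exists w.
    exact: Qcov bL wb.
  apply: le_trans Qsum _; apply: (@le_trans _ _ (K%:R * K.+2%:R^-1)).
    by rewrite ler_wpM2l.
  by rewrite ler_pdivrMr// mul1r ler_nat; lia.
elim: L L0 L1 {AL sumL} => [|b L IHL] L0 L1.
  by exists [::]; split=> //; rewrite !big_nil mulr0.
have [b' b'L|b' b'L|Q [Qsize Qcov Qsum]] := IHL.
- by apply: L0; rewrite inE b'L orbT.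
- by apply: L1; rewrite inE b'L orbT.
have [Qb [Qbs Qbr Qbcov]] := hK b.1 b.2 (L0 _ (mem_head _ _)) (L1 _ (mem_head _ _)).
exists (Qb ++ Q); split.
- move=> u; rewrite mem_cat => /orP[/Qbr[]//|]; exact: Qsize.
- move=> w b'; rewrite inE => /orP[/eqP ->|b'L] wb.
    by have [u uQ wu] := Qbcov _ wb; exists u; rewrite // mem_cat uQ.
  by have [u uQ wu] := Qcov _ _ b'L wb; exists u; rewrite // mem_cat uQ orbT.
- rewrite big_cat big_cons mulrDr/= lerD//.
  apply: (@le_trans _ _ (\sum_(u <- Qb) b.2 `^ t)).
    rewrite big_seq [leRHS]big_seq; apply: ler_sum => u /Qbr[_ _ ub].
    rewrite ge0_ler_powR ?(ltW t0)// nnegrE.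
      exact/ltW/(word_ratio_gt0 _ _ hf).
    by apply/ltW/L0; exact: mem_head.
  rewrite big_const_seq count_predT iter_addr_0 -[leLHS]mulr_natl.
  by rewrite ler_wpM2r ?powR_ge0// ler_nat.
Qed.

Lemma word_sum_bounded (A : set (code_space N)) t :
  (forall w, A w -> A (shift_by p w)) -> compact (coding f @` A) -> 0 < t ->
  hausdorff_measure t (coding f @` A) = 0%E ->
  exists B : R, forall m,
    \sum_(u <- word_list A (m * p)) word_ratio rho u `^ t <= B.
Proof.
move=> Ap cA t0 At; have [Q [Qs Qcov Qsum]] := stopping_cover _ _ cA t0 At.
have Ashift m w : A w -> A (shift_by (m * p) w).
  move=> Aw; elim: m => [|m IHm]; first by rewrite mul0n shift_by0.
  by rewrite mulSn addnC -shift_byD; exact: Ap.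
pose Z m := \sum_(u <- word_list A (m * p)) word_ratio rho u `^ t.
have Z0 m : 0 <= Z m by apply: sumr_ge0 => u _; exact: powR_ge0.
(* For [m] beyond [l] every word of [A^(m p)] is longer than the words of [Q], so a prefix can be
   split off; [B] trivially dominates the finitely many earlier sums. *)
pose l := \max_(u <- Q) size u.
pose B := \sum_(0 <= m < l.+1) Z m.
have B0 : 0 <= B by apply: sumr_ge0.
exists B => m; rewrite -/(Z m); have [k] := ubnP m.
elim: k m => // k IHk m; rewrite ltnS => mk.
have [ml|lm] := leqP m l.
  rewrite /B (bigD1_seq m) ?mem_index_iota ?iota_uniq ?ltnS//= lerDl.
  exact: sumr_ge0.
have Ql u : u \in Q -> (size u < m)%N.
  move=> uQ; apply: leq_ltn_trans lm; rewrite /l.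
  exact: (@leq_bigmax_seq _ _ xpredT size).
apply: (@le_trans _ _ (\sum_(u <- Q) word_ratio rho u `^ t * B)); last first.
  by rewrite -mulr_suml ler_piMl.
(* Divisibility of [size u] by [p] keeps the remainder a prefix of a code in [A]. A word may split
   in several ways, so this is only an inequality. *)
apply: (@le_trans _ _ (\sum_(u <- Q) \sum_(v <- word_list A ((m - size u %/ p) * p))
    word_ratio rho (u ++ v) `^ t)).
  rewrite -(big_allpairs_dep (h := fun u v => u ++ v)
    (F := fun x => word_ratio rho x `^ t)).
  apply: ler_sum_subset => [|u /word_listP[w Aw wu]|u].
  - exact: word_list_uniq.
  - have [v vQ wv] := Qcov _ Aw; have [pv v0] := Qs _ vQ.
    have vm : (size v <= m * p)%N.
      by apply: leq_trans (ltnW (Ql _ vQ)) _; rewrite leq_pmulr.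
    apply/allpairsPdep; exists v, (prefix_word (shift_by (size v) w) (m * p - size v)).
    split=> //; last by rewrite -wu -[in LHS](subnKC vm) prefix_wordD wv.
    apply/word_listP; exists (shift_by (size v) w).
      by rewrite -(divnK pv); exact: Ashift.
    by rewrite mulnBl divnK.
  - exact: powR_ge0.
rewrite big_seq [leRHS]big_seq; apply: ler_sum => u uQ.
have [pu u0] := Qs _ uQ.
under eq_bigr => v _.
  rewrite word_ratio_cat powRM; [|exact/ltW/(word_ratio_gt0 _ _ hf)..].
  over.
rewrite -mulr_sumr ler_wpM2l ?powR_ge0//; apply: IHk.
have : (0 < size u %/ p)%N by rewrite divn_gt0// dvdn_leq.
have := Ql _ uQ; lia.
Qed.

End OpenSetCondition.

(** * The equation defining [s_k] *)

Lemma powR_continuous_exp {R : realType} (a : R) : 0 < a -> continuous (powR a).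
Proof.
move=> a0 x; rewrite /powR gt_eqF//.
apply: (@cvg_comp _ _ _ (fun y => y * ln a) expR); last exact: continuous_expR.
by apply: cvgM; [exact: cvg_id|exact: cvg_cst].
Qed.

Lemma ltr_powR_exp {R : realType} (a x y : R) : 0 < a -> a < 1 -> x < y ->
  a `^ y < a `^ x.
Proof.
move=> a0 a1 xy; rewrite /powR gt_eqF// ltr_expR ltr_nM2r// ln_lt0// a0.
exact: a1.
Qed.

(** Each summand decreases strictly, [W 0] counts the list and is at least 1, and [W] tends to 0
    along the integers; the intermediate value theorem gives the root. *)
Lemma moran_root {R : realType} {T : eqType} (L : seq T) (r : T -> R) :
  (forall u, u \in L -> 0 < r u < 1) -> L != [::] ->
  let W t := \sum_(u <- L) r u `^ t in
  {homo W : x y /~ x < y} /\ exists2 s, 0 <= s & W s = 1.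
Proof.
move=> r01 L0 W.
have Wdec : {homo W : x y /~ x < y}.
  move=> y x xy; rewrite /W; case: L L0 r01 @W => // u L _ r01 _.
  rewrite !big_cons ltr_leD//.
    by have /andP[u0 u1] := r01 _ (mem_head _ _); exact: ltr_powR_exp.
  rewrite big_seq [leRHS]big_seq; apply: ler_sum => v vL.
  have /andP[v0 v1] : 0 < r v < 1 by apply: r01; rewrite inE vL orbT.
  exact/ltW/ltr_powR_exp.
split=> //.
have W0 : 1 <= W 0.
  rewrite /W (eq_bigr (fun=> 1)) => [|u _]; last by rewrite powRr0.
  by rewrite big_const_seq count_predT iter_addr_0; case: (L) L0 => //= u L' _; rewrite ler1n.
have Wc x : W y @[y --> x] --> W x.
  rewrite /W big_seq; under eq_cvg do rewrite big_seq.
  apply: cvg_big => [|u uL]; first exact: add_continuous.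
  by apply: powR_continuous_exp; have /andP[] := r01 _ uL.
have Wlim : W m%:R @[m --> \oo] --> (0 : R).
  have -> : (0 : R) = \sum_(u <- L | u \in L) 0 by rewrite big1.
  rewrite /W; under eq_cvg do rewrite big_seq.
  apply: cvg_big => [|u uL]; first exact: add_continuous.
  have /andP[u0 u1] := r01 _ uL.
  under eq_cvg do rewrite powR_mulrn ?(ltW u0)//.
  by apply: cvg_expr; rewrite gtr0_norm.
have /cvgrPdist_lt/(_ _ ltr01)[m _ /(_ m (leqnn m))/=] := Wlim.
rewrite sub0r normrN ger0_norm; last by apply: sumr_ge0 => u _; exact: powR_ge0.
move=> Wm; have [||s] := @IVT R W 0 m%:R 1 (ler0n _ m).
- exact: continuous_subspaceT.
- by rewrite ge_min le_max (ltW Wm) W0 orbT.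
by rewrite in_itv/= => /andP[s0 _] Ws; exists s.
Qed.

(** * Sums over words of block codes *)

Section BlockSums.
Context {R : realType} {n N : nat}.
Variables (f : 'I_N -> 'rV[R]_n -> 'rV[R]_n) (rho : 'I_N -> R).
Hypothesis hf : forall i, contracting_similarity (f i) (rho i).
Variables (S : set (code_space N)) (k : nat).
Hypotheses (k0 : (0 < k)%N).

Local Notation W t := (\sum_(u <- word_list S k) word_ratio rho u `^ t).

Lemma words_block_codesS m u :
  words (block_codes S k) (m.+1 * k) u <->
  exists u1 u2, [/\ words S k u1, words (block_codes S k) (m * k) u2
    & u = u1 ++ u2].
Proof.
split=> [[w Sw <-]|[u1 [u2 [Su1 [w Sw <-] ->]]]].
  exists (prefix_word w k), (prefix_word (shift_by k w) (m * k)); split.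
  - exact: prefix_block_codes.
  - by exists (shift_by k w) => //; exact: shift_block_codes.
  - by rewrite mulSn prefix_wordD.
have u1k : size u1 = k by have [v _ <-] := Su1; rewrite size_prefix_word.
exists (cat_code u1 w); first exact: cat_block_codes.
by rewrite mulSn -[X in (X + _)%N]u1k prefix_cat_code.
Qed.

(** Blocks concatenate freely and uniquely, and ratios are multiplicative, so the sum factorises. *)
Lemma block_codes_sum (S0 : S !=set0) (Sshift : shift_closed S) m t :
  \sum_(u <- word_list (block_codes S k) (m * k)) word_ratio rho u `^ t =
  W t ^+ m.
Proof.
elim: m => [|m IHm].
  have -> : word_list (block_codes S k) (0 * k) = [:: [::]].
    apply: perm_small_eq => //; apply: uniq_perm => //; first exact: word_list_uniq.
    move=> u; rewrite inE; apply/idP/eqP => [/word_listP[w _ <-]|->].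
      by rewrite mul0n.
    apply/word_listP; have [w Sw] := S0.
    by exists w; [exact: sub_block_codes|rewrite mul0n].
  by rewrite big_seq1 /word_ratio big_nil powR1 expr0.
have szS u : u \in word_list S k -> size u = k.
  by move=> /word_listP[w _ <-]; rewrite size_prefix_word.
rewrite exprS -IHm mulr_suml.
transitivity (\sum_(u <- [seq u ++ v | u <- word_list S k,
    v <- word_list (block_codes S k) (m * k)]) word_ratio rho u `^ t).
  apply: perm_big; apply: uniq_perm; first exact: word_list_uniq.
    apply: allpairs_uniq; [exact: word_list_uniq|exact: word_list_uniq|].
    move=> _ _ /allpairsP[[u v] /= [uS _ ->]] /allpairsP[[u' v'] /= [u'S _ ->]] /=.
    move=> /eqP; rewrite eqseq_cat; last by rewrite !szS.
    by move=> /andP[/eqP -> /eqP ->].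
  move=> u; apply/word_listP/allpairsP.
    move=> /words_block_codesS[u1 [u2 [Su1 Su2 ->]]]; exists (u1, u2) => /=.
    by split=> //; apply/word_listP.
  move=> [[u1 u2] /= [/word_listP Su1 /word_listP Su2 ->]].
  by apply/words_block_codesS; exists u1, u2.
rewrite big_allpairs_dep; apply: eq_bigr => u _; rewrite mulr_sumr.
apply: eq_bigr => v _; rewrite word_ratio_cat powRM//.
  exact/ltW/(word_ratio_gt0 _ _ hf).
exact/ltW/(word_ratio_gt0 _ _ hf).
Qed.

(** The cylinders of [m] blocks cover the set, with diameters at most [q ^+ (m * k) * D] and power
    sum at most [W t ^+ m * D ^ t]; both bounds tend to 0. *)
Lemma block_set_measure0 (S0 : S !=set0) (Sshift : shift_closed S) t :
  0 <= t -> W t < 1 -> hausdorff_measure t (block_set f S k) = 0%E.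
Proof.
move=> t0 W1; apply: hausdorff_measure0_le => // e e0.
have [D D0 hD] := eucl_coding _ _ hf.
have [c [q [c0 q1 q0 cq]]] := ratio_bounds _ _ hf.
have W0 : 0 <= W t by apply: sumr_ge0 => u _; exact: powR_ge0.
have lim1 : q ^+ m * D @[m --> \oo] --> (0 : R).
  rewrite -(mul0r D); apply: cvgM; last exact: cvg_cst.
  by apply: cvg_expr; rewrite gtr0_norm.
have lim2 : W t ^+ m * D `^ t @[m --> \oo] --> (0 : R).
  rewrite -[X in _ --> X](mul0r (D `^ t)); apply: cvgM; last exact: cvg_cst.
  by apply: cvg_expr; rewrite ger0_norm.
have /cvgrPdist_lt/(_ _ e0)[m1 _ hm1] := lim1.
have /cvgrPdist_lt/(_ _ e0)[m2 _ hm2] := lim2.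
pose m := maxn m1 m2.
pose cyl u := coding f @` [set w | block_codes S k w /\ prefix_word w (m * k) = u].
exists [seq (cyl u, word_ratio rho u * D) |
  u <- word_list (block_codes S k) (m * k)]; split.
- move=> _ [w Sw <-].
  exists (cyl (prefix_word w (m * k)), word_ratio rho (prefix_word w (m * k)) * D).
    apply: (map_f (fun u => (cyl u, word_ratio rho u * D))).
    by apply/word_listP; exists w.
  by exists w.
- move=> _ /mapP[u /word_listP[v _ vu] ->] /=; split.
    apply: ge_ereal_sup => _ [_ [_ [[w [_ wu] <-] [w' [_ w'u] <-] ->]]].
    rewrite lee_fin -wu; apply: (hD w w' (m * k)%N).
    by rewrite wu w'u.
  have := hm1 (m * k)%N; rewrite /= sub0r normrN ger0_norm; last first.
    by rewrite mulr_ge0 ?(ltW D0)// exprn_ge0// ltW.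
  have -> : (m1 <= m * k)%N.
    by apply: leq_trans (leq_pmulr _ k0); rewrite leq_maxl.
  move=> /(_ isT) /ltW; apply: le_trans; rewrite ler_wpM2r ?(ltW D0)//.
  by have /andP[_] := cq u; rewrite -vu size_prefix_word.
- rewrite big_map/=.
  under eq_bigr => u _.
    rewrite powRM ?(ltW D0)//; last exact/ltW/(word_ratio_gt0 _ _ hf).
    over.
  rewrite -mulr_suml block_codes_sum//.
  have := hm2 m; rewrite /= leq_maxr sub0r normrN ger0_norm.
    by move=> /(_ isT)/ltW.
  by rewrite mulr_ge0 ?powR_ge0// exprn_ge0.
Qed.

End BlockSums.

(** * The dimension of [E_k], and the comparison with [E] *)

Section BlockDimension.
Context {R : realType} {n N : nat}.
Variables (f : 'I_N -> 'rV[R]_n -> 'rV[R]_n) (rho : 'I_N -> R).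
Hypothesis hf : forall i, contracting_similarity (f i) (rho i).
Variables (S : set (code_space N)).
Hypotheses (S0 : S !=set0) (Sshift : shift_closed S).

Local Notation W k t := (\sum_(u <- word_list S k) word_ratio rho u `^ t).

Lemma block_moran_root k : (0 < k)%N ->
  {homo (fun t => W k t) : x y /~ x < y} /\ exists2 s, 0 <= s & W k s = 1.
Proof.
move=> k0; apply: moran_root => [u /word_listP[w _ wu]|].
  have uk : size u = k by rewrite -wu size_prefix_word.
  by rewrite (word_ratio_gt0 _ _ hf) (word_ratio_lt1 _ _ hf)// uk.
have [w Sw] := S0; apply/negP => /eqP Wnil.
have : prefix_word w k \in word_list S k by apply/word_listP; exists w.
by rewrite Wnil.
Qed.

Lemma block_set_dim_le k s : (0 < k)%N -> 0 <= s -> W k s = 1 ->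
  (hausdorff_dim (block_set f S k) <= s%:E)%E.
Proof.
move=> k0 s0 Ws; apply/lee_addgt0Pr => e e0; rewrite -EFinD.
have [Wdec _] := block_moran_root _ k0.
have se0 : 0 <= s + e by rewrite addr_ge0// ltW.
apply: hausdorff_dim_le => //; apply: (block_set_measure0 _ _ hf) => //.
by rewrite -[ltRHS]Ws; apply: (Wdec _ _); rewrite ltrDl.
Qed.

(** A smaller dimension would give measure 0 at some [t < s], where [W k t > 1]; but then the powers
    of [W k t] would be bounded. *)
Lemma block_set_dim_ge C k s : inhom_open_set_condition f C ->
  (0 < k)%N -> W k s = 1 ->
  (s%:E <= hausdorff_dim (block_set f S k))%E.
Proof.
move=> [U [[U0 _ oU] fU dU _]] k0 Ws; rewrite leNgt; apply/negP.
have bs0 := block_set_nonempty f S k S0 Sshift.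
move=> /(hausdorff_dim_lt _ _ bs0)[t [t0 ts Ht]].
have [Wdec _] := block_moran_root _ k0.
have Wt1 : 1 < W k t by rewrite -[ltLHS]Ws; exact: (Wdec _ _ ts).
have [B hB] := word_sum_bounded _ _ hf _ oU U0 fU dU _ k0 _ _
  (@shift_block_codes _ S k) (block_set_compact _ _ hf S k) t0 Ht.
have B0 : 0 < B.
  by apply: lt_le_trans (hB 0); rewrite (block_codes_sum _ _ hf)// expr0.
have Wt0 : 0 < W k t := lt_trans ltr01 Wt1.
have V1 : 0 < (W k t)^-1 by rewrite invr_gt0.
have : (W k t)^-1 ^+ m @[m --> \oo] --> (0 : R).
  by apply: cvg_expr; rewrite gtr0_norm// invf_lt1.
have Bi : 0 < B^-1 by rewrite invr_gt0.
move=> /cvgrPdist_lt/(_ _ Bi)[m _ /(_ m (leqnn m))/=].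
rewrite sub0r normrN ger0_norm ?exprn_ge0 ?(ltW V1)// exprVn.
rewrite ltf_pV2 ?posrE ?exprn_gt0//.
rewrite ltNge => /negP; apply.
by have := hB m; rewrite (block_codes_sum _ _ hf).
Qed.

(* The sums over S^k stay bounded at some exponent t' < t, hence decay
   geometrically at t. *)
Lemma block_root_le_dim C t : inhom_open_set_condition f C ->
  compact (coding f @` S) -> (hausdorff_dim (coding f @` S) < t%:E)%E ->
  \forall k \near \oo, forall s, W k s = 1 -> s < t.
Proof.
move=> [U [[U0 _ oU] fU dU _]] cE.
have E0 : coding f @` S !=set0 by have [w Sw] := S0; exists (coding f w), w.
move=> /(hausdorff_dim_lt _ _ E0)[t' [t'0 t't Ht']].
have [B hB] := word_sum_bounded _ _ hf _ oU U0 fU dU _ (ltn0Sn 0) _ _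
  (fun w => @shift_closed_by _ S 1 w Sshift) cE t'0 Ht'.
have [c [q [c0 q1 q0 cq]]] := ratio_bounds _ _ hf.
(* A word of length [m] has ratio at most [q ^+ m], so raising the exponent from [t'] to [t] gains a
   factor [a ^+ m]. *)
pose a := q `^ (t - t').
have a0 : 0 <= a := powR_ge0 _ _.
have a1 : a < 1 by rewrite -(powRr0 q); apply: ltr_powR_exp; rewrite ?subr_gt0.
have : a ^+ m * B @[m --> \oo] --> (0 : R).
  rewrite -(mul0r B); apply: cvgM; last exact: cvg_cst.
  by apply: cvg_expr; rewrite ger0_norm.
move=> /cvgrPdist_lt/(_ _ ltr01)[m0 _ hm0].
exists m0.+1 => // m /= m0m s Ws.
have m_gt0 : (0 < m)%N by apply: leq_trans m0m.
have [Wdec _] := block_moran_root _ m_gt0.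
(* If [t <= s], monotonicity makes the sum at [t] at least 1, against the bound [a ^+ m * B < 1]. *)
rewrite ltNge; apply/negP => ts.
have Wt1 : 1 <= W m t.
  by move: ts; rewrite le_eqVlt => /orP[/eqP ->|/Wdec /ltW]; rewrite -?Ws ?lexx.
have := hm0 m (ltnW m0m); rewrite /= sub0r normrN ltNge => /negP; apply.
rewrite (le_trans Wt1)// (le_trans _ (ler_norm _))//.
apply: (@le_trans _ _ (a ^+ m * W m t')); last first.
  by rewrite ler_wpM2l ?exprn_ge0//; have := hB m; rewrite muln1.
rewrite mulr_sumr big_seq [leRHS]big_seq.
apply: ler_sum => u /word_listP[w _ wu].
have um : size u = m by rewrite -wu size_prefix_word.
have r0 := word_ratio_gt0 _ _ hf u.
rewrite -[X in _ `^ X](subrK t') powRD; last by rewrite (gt_eqF r0) implybT.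
rewrite ler_wpM2r ?powR_ge0// /a -powR_mulrn ?powR_ge0// powRAC.
rewrite powR_mulrn ?(ltW q0)//.
rewrite ge0_ler_powR ?subr_ge0 ?(ltW t't)// ?nnegrE ?(ltW r0) ?exprn_ge0 ?(ltW q0)//.
by have /andP[_] := cq u; rewrite um.
Qed.

End BlockDimension.

Theorem corollary5p4 (R : realType) (n N : nat)
    (f : 'I_N -> 'rV[R]_n -> 'rV[R]_n) (rho : 'I_N -> R)
    (hf : forall i, contracting_similarity (f i) (rho i))
    (C : set 'rV[R]_n) (hC0 : C !=set0) (hC : compact C)
    (E : set 'rV[R]_n) (hE : sub_self_similar f E)
    (S : set (code_space N)) (hS : compact S) (hshift : shift_closed S)
    (hES : E = coding f @` S) :
  exists (M : nat -> nat) (I : forall k, 'I_(M k) -> 'rV[R]_n -> 'rV[R]_n)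
         (Ek : nat -> set 'rV[R]_n),
    (forall k, (0 < k)%N ->
       [/\ is_IFS (I k),
           sub_self_similar (I k) (Ek k)
         & inhom_sub_self_similar (I k) C (Ek k `|` orbital_set f S C)]) /\
    (inhom_open_set_condition f C ->
     exists s : nat -> R,
       [/\ (forall k, (0 < k)%N ->
              hausdorff_dim (Ek k) = (s k)%:E /\
              forall t : R,
                \sum_(u \in words S k) word_ratio rho u `^ t = 1 <-> t = s k),
           hausdorff_dim (Ek k) @[k --> \oo] --> hausdorff_dim E
         & (s k)%:E @[k --> \oo] --> hausdorff_dim E]).
Proof.
have [E0 cE _] := hE.
have S0 : S !=set0 by move: E0; rewrite hES => -[_ [w Sw _]]; exists w.
exists (fun k => size (short_words S k)), (fun k => block_ifs f S k),
  (fun k => block_set f S k); split=> [k k0|osc].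
  split; [exact: block_ifs_IFS hf _ _|exact: block_set_sss|exact: block_set_isss].
(* At [k = 0] a dummy value is chosen. *)
have /choice[s hs] : forall k, exists s : R, (0 < k)%N -> 0 <= s /\
    \sum_(u <- word_list S k) word_ratio rho u `^ s = 1.
  move=> k; have [->|] := posnP k; first by exists 0.
  by move=> /(block_moran_root _ _ hf _ S0)[_ [s s0 Ws]]; exists s.
have dimk k : (0 < k)%N -> hausdorff_dim (block_set f S k) = (s k)%:E.
  move=> k0; have [s0 Ws] := hs _ k0.
  apply/eqP; rewrite eq_le (block_set_dim_le _ _ hf)//=.
  exact: (block_set_dim_ge _ _ hf _ S0 hshift _ _ _ osc).
have Ele k : (0 < k)%N -> (hausdorff_dim E <= (s k)%:E)%E.
  move=> k0; rewrite -dimk// hES; apply: hausdorff_dim_mono.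
  exact: coding_image_sub_block_set.
(* Finiteness, from the bound by [s 1], lets the convergence be proved in the reals: [E] inside
   [E_k] bounds [s k] from below, [block_root_le_dim] from above. *)
have Efin : hausdorff_dim E \is a fin_num.
  rewrite ge0_fin_numE ?hausdorff_dim_ge0//.
  exact: le_lt_trans (Ele 1%N _) (ltry _).
have slim : (s k)%:E @[k --> \oo] --> hausdorff_dim E.
  rewrite -(fineK Efin); apply: cvg_EFin; first exact: nearW.
  apply/cvgrPdist_lt => e e0.
  have Elt : (hausdorff_dim E < (fine (hausdorff_dim E) + e)%:E)%E.
    by rewrite EFinD fineK// lteDl// lte_fin.
  have cES : compact (coding f @` S) by rewrite -hES.
  rewrite hES in Elt; have := block_root_le_dim _ _ hf _ S0 hshift _ _ osc cES Elt.
  rewrite -hES => -[m _ hm]; exists m.+1 => // k /= mk.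
  have k0 : (0 < k)%N by apply: leq_trans mk.
  have [_ /(hm _ (ltnW mk)) ske] := hs _ k0.
  have := Ele _ k0; rewrite -(fineK Efin) lee_fin => sk.
  by rewrite ltr_norml; apply/andP; split; lra.
exists s; split=> //.
- move=> k k0; split; first exact: dimk.
  have [s0 Ws] := hs _ k0; have [Wdec _] := block_moran_root _ _ hf _ S0 _ k0.
  move=> t; rewrite fsbig_words; split=> [Wt|->//].
  have [ts|ts|//] := ltgtP t (s k); by have := Wdec _ _ ts; rewrite Wt Ws ltxx.
- apply: cvg_trans slim; apply: near_eq_cvg.
  by exists 1%N => // k /= k0; rewrite dimk.
Qed.
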